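(* Let $\gamma>1$, $0<r_0<r_1$, $\rho_0>0$, $A_0>0$, $U_{10}>0$, $U_{20}\in\mathbb{R}$, and consider Problem I on $\Omega=\{r_0<r<r_1\}$: find smooth $(U_1,U_2,\rho,A)(r)$ solving $$(\rho U_1)'+\tfrac1r\rho U_1=0,\quad U_1U_1'+\tfrac1\rho p'-\tfrac{U_2^2}{r}=0,\quad U_1U_2'+\tfrac{U_1U_2}{r}=0,\quad U_1A'=0,\qquad r_0<r<r_1,$$ with $p=A\rho^\gamma$ and $\rho(r_0)=\rho_0,\ U_1(r_0)=U_{10},\ U_2(r_0)=U_{20},\ A(r_0)=A_0$. Then: (1) If $U_1^2(r_0)>c^2(r_0)$ (incoming flow supersonic in the $r$-direction), there exists a unique supersonic smooth solution to Problem I in $\Omega$. (2) If $|\mathbf U|^2(r_0)<c^2(r_0)$ (incoming flow subsonic), there exists a unique subsonic smooth solution to Problem I in $\Omega$. (3) If $|\mathbf U|^2(r_0)>c^2(r_0)>U_1^2(r_0)$, then the constant $$r_c=\sqrt{\frac{(\gamma+1)(\kappa_1^2+\kappa_2^2\rho_c^2)}{2(\gamma-1)B_0\rho_c^2}},$$ which depends only on $r_0,\gamma$ and the incoming flow, satisfies $r_c>r_0$, and (a) if $r_1>r_c$, there exists a unique smooth transonic solution to Problem I in $\Omega$; (b) if $r_1<r_c$, there exists a unique smooth supersonic solution to Problem I in $\Omega$; (c) if $r_1=r_c$, there exists a unique smooth supersonic-sonic solution to Problem I in $\Omega$, with sonic circle located at $r=r_c$.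
   Context: Radially symmetric steady compressible Euler flow: velocity $\mathbf u=U_1(r)\mathbf e_r+U_2(r)\mathbf e_\theta$, density $\rho(r)>0$, pressure $p=A\rho^\gamma$ with $A(r)>0$ a function of the entropy. Sound speed $c^2=\gamma p/\rho=\gamma A\rho^{\gamma-1}$; $|\mathbf U|^2=U_1^2+U_2^2$. The flow is supersonic, sonic or subsonic at $r$ if $|\mathbf U|^2>c^2$, $=c^2$, $<c^2$ respectively at $r$; a sonic circle is a circle on which the flow is sonic. A solution is supersonic (subsonic) in $\Omega$ if it is so at every point of $\Omega$; transonic if it changes smoothly between supersonic and subsonic inside $\Omega$; supersonic-sonic if it is supersonic in $\Omega$ and sonic at the exit $r=r_1$. A smooth solution means functions that are $C^1$ on $(r_0,r_1)$, continuous on $[r_0,r_1]$, satisfying the system and the boundary conditions. Constants: $\kappa_1=r_0\rho_0U_{10}$, $\kappa_2=r_0U_{20}$, $B_0=\frac12(U_{10}^2+U_{20}^2)+\frac{\gamma A_0}{\gamma-1}\rho_0^{\gamma-1}$, $\rho_c=\left(\frac{2(\gamma-1)B_0}{(\gamma+1)\gamma A_0}\right)^{1/(\gamma-1)}$. *)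

(* Defs.v *)
From Stdlib Require Import Reals.
From Coquelicot Require Import Coquelicot.
Open Scope R_scope.

(* Only the values on [r0, r1] are meaningful; the fields are total functions
   for the sake of [Derive]. *)
Record flow : Type := Flow {
  U1 : R -> R;   (* radial velocity *)
  U2 : R -> R;   (* angular velocity component, along e_theta *)
  rho : R -> R;  (* density *)
  A : R -> R     (* entropy function *)
}.

(* [Rpower x y] is exp (y * ln x), the real power only for x > 0; the density
   is required to be positive wherever it occurs. *)
Definition pressure (gamma rho A : R) : R := A * Rpower rho gamma.

(* c^2 *)
Definition sound_speed_sqr (gamma rho A : R) : R :=
  gamma * pressure gamma rho A / rho.

(* |U|^2 *)
Definition speed_sqr (u1 u2 : R) : R := u1 ^ 2 + u2 ^ 2.

Definition supersonic_at (gamma : R) (S : flow) (r : R) : Prop :=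
  speed_sqr (U1 S r) (U2 S r) > sound_speed_sqr gamma (rho S r) (A S r).

Definition sonic_at (gamma : R) (S : flow) (r : R) : Prop :=
  speed_sqr (U1 S r) (U2 S r) = sound_speed_sqr gamma (rho S r) (A S r).

Definition subsonic_at (gamma : R) (S : flow) (r : R) : Prop :=
  speed_sqr (U1 S r) (U2 S r) < sound_speed_sqr gamma (rho S r) (A S r).

(* Continuity on [a, b] is relative to [a, b], hence one-sided at a and b. *)
Definition smooth_on (a b : R) (f : R -> R) : Prop :=
  (forall r, a < r < b -> ex_derive f r /\ continuous (Derive f) r) /\
  continuous_on (fun r => a <= r <= b) f.

Definition euler_at (gamma : R) (S : flow) (r : R) : Prop :=
  Derive (fun s => rho S s * U1 S s) r + 1 / r * (rho S r * U1 S r) = 0 /\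
  U1 S r * Derive (U1 S) r
    + 1 / rho S r * Derive (fun s => pressure gamma (rho S s) (A S s)) r
    - U2 S r ^ 2 / r = 0 /\
  U1 S r * Derive (U2 S) r + U1 S r * U2 S r / r = 0 /\
  U1 S r * Derive (A S) r = 0.

Definition smooth_solution
    (gamma r0 r1 rho0 A0 U10 U20 : R) (S : flow) : Prop :=
  (smooth_on r0 r1 (U1 S) /\ smooth_on r0 r1 (U2 S) /\
   smooth_on r0 r1 (rho S) /\ smooth_on r0 r1 (A S)) /\
  (forall r, r0 <= r <= r1 -> 0 < rho S r /\ 0 < A S r) /\
  (forall r, r0 < r < r1 -> euler_at gamma S r) /\
  (rho S r0 = rho0 /\ U1 S r0 = U10 /\ U2 S r0 = U20 /\ A S r0 = A0).

Definition supersonic (gamma r0 r1 : R) (S : flow) : Prop :=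
  forall r, r0 < r < r1 -> supersonic_at gamma S r.

Definition subsonic (gamma r0 r1 : R) (S : flow) : Prop :=
  forall r, r0 < r < r1 -> subsonic_at gamma S r.

(* The change of type takes place across a sonic circle r = rs inside the
   domain, in either direction.  That it is smooth is part of
   [smooth_solution], which gives C^1 regularity at rs. *)
Definition transonic (gamma r0 r1 : R) (S : flow) : Prop :=
  exists rs, r0 < rs < r1 /\ sonic_at gamma S rs /\
    ((supersonic gamma r0 rs S /\ subsonic gamma rs r1 S) \/
     (subsonic gamma r0 rs S /\ supersonic gamma rs r1 S)).

Definition supersonic_sonic (gamma r0 r1 : R) (S : flow) : Prop :=
  supersonic gamma r0 r1 S /\ sonic_at gamma S r1.

Definition flow_eq_on (a b : R) (S T : flow) : Prop :=
  forall r, a <= r <= b ->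
    U1 S r = U1 T r /\ U2 S r = U2 T r /\ rho S r = rho T r /\ A S r = A T r.

Definition exists_unique_flow (a b : R) (P : flow -> Prop) : Prop :=
  exists S, P S /\ forall T, P T -> flow_eq_on a b S T.

Definition kappa1 (r0 rho0 U10 : R) : R := r0 * rho0 * U10.

Definition kappa2 (r0 U20 : R) : R := r0 * U20.

Definition B0 (gamma rho0 A0 U10 U20 : R) : R :=
  1 / 2 * (U10 ^ 2 + U20 ^ 2)
  + gamma * A0 / (gamma - 1) * Rpower rho0 (gamma - 1).

Definition rho_c (gamma rho0 A0 U10 U20 : R) : R :=
  Rpower (2 * (gamma - 1) * B0 gamma rho0 A0 U10 U20
            / ((gamma + 1) * gamma * A0))
         (1 / (gamma - 1)).

Definition r_c (gamma r0 rho0 A0 U10 U20 : R) : R :=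
  let rc := rho_c gamma rho0 A0 U10 U20 in
  sqrt ((gamma + 1) * (kappa1 r0 rho0 U10 ^ 2 + kappa2 r0 U20 ^ 2 * rc ^ 2)
          / (2 * (gamma - 1) * B0 gamma rho0 A0 U10 U20 * rc ^ 2)).

(* Main.v *)
Require Import Defs.
From Stdlib Require Import Reals.
From Coquelicot Require Import Coquelicot.
From Stdlib Require Import Lra Ranalysis5.
Open Scope R_scope.

(** Mass, angular momentum, entropy and the Bernoulli quantity are conserved:
    [r * rho * U1 = k1], [r * U2 = k2], [A = A0] and
    [(U1 ^ 2 + U2 ^ 2) / 2 + K * rho ^ (gamma - 1) = B], where
    [K = gamma * A0 / (gamma - 1)] ([first_integrals]).  Substituting the
    velocities into Bernoulli's law gives an equation between [rho] and [r] that
    can be solved for the radius,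
      [r ^ 2 = (k1 ^ 2 / rho ^ 2 + k2 ^ 2) / (2 * (B - K * rho ^ (gamma - 1)))],
    and solving the Euler system amounts to inverting the function [radius_sqr]
    on the right.

    Its derivative has the sign of [margin], an increasing function of [rho]
    which, along a flow, is a positive multiple of [c ^ 2 - U1 ^ 2].  So
    [radius_sqr] decreases from infinity at vacuum to a minimum, where
    [U1 ^ 2 = c ^ 2], and increases back to infinity at the stagnation density.
    An inflow with [U1 ^ 2 <> c ^ 2] lies in the interior of one of the two
    branches, and inverting that branch gives a flow for all [r >= r0].  Any
    other solution starts on the same branch and by continuity cannot leave it,
    because at the ends of the piece of branch in use the radius is outside
    [[r0, r1]] ([density_branch]).  This gives existence and uniqueness among
    all smooth solutions, whatever their type
    ([smooth_solution_exists_unique]).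

    The type is read off from the density: [|U| ^ 2 - c ^ 2] equals
    [2 * B - (gamma + 1) * K * rho ^ (gamma - 1)], which decreases in [rho] and
    vanishes at [rho_c].  On the vacuum branch [U1 ^ 2 > c ^ 2], so the flow is
    supersonic.  On the other branch the density grows with the radius: a
    subsonic inflow, with [rho0 > rho_c], stays subsonic, whereas a supersonic
    one crosses [rho_c] once, at the radius with
    [r ^ 2 = radius_sqr rho_c = r_c ^ 2]; the three subcases compare [r1] with
    [r_c]. *)

(** * Real functions of one variable *)

Lemma is_derive_continuity_pt (f : R -> R) (x l : R) :
  is_derive f x l -> continuity_pt f x.
Proof.
  intros H. apply continuity_pt_filterlim.
  apply (ex_derive_continuous f x). now exists l.
Qed.

Lemma continuous_Rplus (f g : R -> R) (x : R) :
  continuous f x -> continuous g x -> continuous (fun y => f y + g y) x.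
Proof. exact (continuous_plus (V := R_NormedModule) f g x). Qed.

Lemma continuous_Rmult (f g : R -> R) (x : R) :
  continuous f x -> continuous g x -> continuous (fun y => f y * g y) x.
Proof. exact (continuous_mult (K := R_AbsRing) f g x). Qed.

Lemma continuous_pos (f : R -> R) (x : R) :
  continuous f x -> 0 < f x ->
  exists d, 0 < d /\ forall y, Rabs (y - x) < d -> 0 < f y.
Proof.
  intros Hc Hx.
  destruct (proj1 (filterlim_locally f (f x)) Hc (mkposreal _ Hx)) as [d Hd].
  exists d. split; [apply cond_pos|]. intros y Hy.
  specialize (Hd y Hy). change (Rabs (f y - f x) < f x) in Hd.
  apply Rabs_lt_between in Hd. lra.
Qed.

Lemma is_derive_Rpower (e x : R) :
  0 < x -> is_derive (fun y => Rpower y e) x (e * Rpower x e / x).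
Proof.
  intros Hx. unfold Rpower. auto_derive; [assumption|]. field. lra.
Qed.

Lemma Rpower_minus_1 (x g : R) : 0 < x -> Rpower x g = x * Rpower x (g - 1).
Proof.
  intros Hx. replace g with (1 + (g - 1)) at 1 by ring.
  now rewrite Rpower_plus, Rpower_1.
Qed.

Lemma constant_of_zero_derive (f : R -> R) (a b : R) :
  (forall x, a <= x <= b -> continuous f x) ->
  (forall x, a < x < b -> is_derive f x 0) ->
  forall x, a <= x <= b -> f x = f a.
Proof.
  intros Hc Hd x Hx.
  destruct (MVT_gen f a x (fun _ => 0)) as [c [_ Hc']].
  - rewrite Rmin_left, Rmax_right by lra. intros y Hy. apply Hd. lra.
  - rewrite Rmin_left, Rmax_right by lra. intros y Hy.
    apply continuity_pt_filterlim, Hc. lra.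
  - lra.
Qed.

(** The scalar [s] carries the sign of [df], so that increasing and decreasing
    branches are inverted at once: [s * f] is increasing in both cases, and an
    inverse of [f] is [y => psi (s * y)] with [psi] an inverse of [s * f]. *)
Lemma inverse_branch (f df : R -> R) (s a b : R) :
  a < b ->
  (forall x, a <= x <= b -> is_derive f x (df x)) ->
  (forall x, a <= x <= b -> 0 < s * df x) ->
  exists phi, forall y, s * f a < s * y < s * f b ->
    a < phi y < b /\ f (phi y) = y /\ is_derive phi y (/ df (phi y)).
Proof.
  intros Hab Hd Hs.
  set (F := fun x => s * f x).
  assert (HF : forall x, a <= x <= b -> is_derive F x (s * df x)).
  { intros x Hx. apply is_derive_scal. now apply Hd. }
  assert (Hinc : forall x y, a <= x -> x < y -> y <= b -> F x < F y).
  { intros x y H1 H2 H3.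
    apply (incr_function_le F a b (fun z => s * df z)); simpl; try assumption.
    - intros z Hz1 Hz2. now apply HF.
    - intros z Hz1 Hz2. now apply Hs. }
  assert (HFc : forall x, a <= x <= b -> continuity_pt F x).
  { intros x Hx. eapply is_derive_continuity_pt. now apply HF. }
  set (psi := fun y =>
    match Rle_dec (F a) y, Rle_dec y (F b) with
    | left h1, left h2 =>
        proj1_sig (f_interv_is_interv F a b y Hab (conj h1 h2) HFc)
    | _, _ => a
    end).
  assert (Hpsi : forall y, F a <= y -> y <= F b -> a <= psi y <= b /\ F (psi y) = y).
  { intros y H1 H2. unfold psi.
    destruct (Rle_dec (F a) y) as [h1|]; [|lra].
    destruct (Rle_dec y (F b)) as [h2|]; [|lra].
    now destruct (f_interv_is_interv F a b y Hab (conj h1 h2) HFc). }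
  assert (HFder : forall x, a <= x <= b -> derivable_pt F x).
  { intros x Hx. exists (s * df x). apply is_derive_Reals. now apply HF. }
  assert (Hder : forall y, F a < y < F b ->
    a < psi y < b /\ is_derive psi y (/ (s * df (psi y)))).
  { intros y Hy.
    destruct (Hpsi y) as [Hr He]; [lra|lra|].
    assert (Hr' : a < psi y < b).
    { split.
      - destruct (Req_dec (psi y) a) as [E|]; [rewrite E in He; lra|lra].
      - destruct (Req_dec (psi y) b) as [E|]; [rewrite E in He; lra|lra]. }
    split; [exact Hr'|].
    assert (Hcont : continuity_pt psi y).
    { apply (continuity_pt_recip_interv F psi a b Hab); try assumption.
      - intros x Hx1 Hx2. now apply Hpsi.
      - intros x Hx1 Hx2. now apply Hpsi. }
    (* The difference quotient of [psi] needs a neighbourhood of [y] on which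
       [psi] stays in the interval where [F] is differentiable. *)
    set (y1 := (F a + y) / 2). set (y2 := (y + F b) / 2).
    assert (Hy12 : F a < y1 < y /\ y < y2 < F b) by (unfold y1, y2; lra).
    assert (Hmono : forall u v, F a <= u -> u <= v -> v <= F b -> psi u <= psi v).
    { intros u v Hu Huv Hv.
      destruct (Hpsi u) as [Hu1 Hu2]; [lra|lra|].
      destruct (Hpsi v) as [Hv1 Hv2]; [lra|lra|].
      destruct (Rle_lt_dec (psi u) (psi v)) as [|Hlt]; [assumption|].
      assert (F (psi v) < F (psi u)) by (apply Hinc; lra). lra. }
    assert (Prf : forall x, psi y1 <= x <= psi y2 -> derivable_pt F x).
    { intros x Hx. apply HFder.
      destruct (Hpsi y1) as [H1 _]; [lra|lra|].
      destruct (Hpsi y2) as [H2 _]; [lra|lra|]. lra. }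
    assert (Hin : psi y1 <= psi y <= psi y2) by (split; apply Hmono; lra).
    assert (Hval : derive_pt F (psi y) (Prf (psi y) Hin) = s * df (psi y)).
    { apply derive_pt_eq_0, is_derive_Reals. now apply HF. }
    apply is_derive_Reals.
    replace (/ (s * df (psi y))) with (1 / derive_pt F (psi y) (Prf (psi y) Hin)).
    - apply (derivable_pt_lim_recip_interv F psi y1 y2 y Prf Hcont); try lra.
      + intros x Hx. unfold comp, id. apply Hpsi; lra.
      + rewrite Hval. specialize (Hs (psi y) Hr). lra.
    - rewrite Hval. unfold Rdiv. now rewrite Rmult_1_l. }
  exists (fun y => psi (s * y)). intros y Hy.
  destruct (Hder (s * y) Hy) as [Hr Hd'].
  destruct (Hpsi (s * y)) as [_ He]; [unfold F; lra|unfold F; lra|].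
  assert (Hsd : 0 < s * df (psi (s * y))) by (apply Hs; lra).
  assert (Hs0 : s <> 0) by (intros E; rewrite E in Hsd; lra).
  split; [exact Hr|split].
  - unfold F in He. now apply Rmult_eq_reg_l with s.
  - replace (/ df (psi (s * y))) with (scal s (/ (s * df (psi (s * y))))).
    + apply (is_derive_comp psi (fun z => s * z)); [exact Hd'|].
      auto_derive; [trivial|ring].
    + change (s * / (s * df (psi (s * y))) = / df (psi (s * y))). field.
      split; [|exact Hs0]. intros E. rewrite E in Hsd. lra.
Qed.

(** Continuity on a closed interval is one-sided at the endpoints, while the
    mean value and intermediate value theorems ask for two-sided continuity;
    composing with the retraction [clamp a b] of the line onto [a, b] turns the
    former into the latter. *)
Definition clamp (a b x : R) : R := Rmax a (Rmin b x).

Lemma clamp_in (a b x : R) : a <= b -> a <= clamp a b x <= b.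
Proof.
  intros H. unfold clamp, Rmax, Rmin.
  destruct (Rle_dec b x), (Rle_dec a _); lra.
Qed.

Lemma clamp_id (a b x : R) : a <= x <= b -> clamp a b x = x.
Proof.
  intros H. unfold clamp. now rewrite Rmin_right, Rmax_right by lra.
Qed.

Lemma clamp_lipschitz (a b x y : R) :
  Rabs (clamp a b y - clamp a b x) <= Rabs (y - x).
Proof.
  unfold clamp, Rmax, Rmin.
  destruct (Rle_dec b x), (Rle_dec b y);
    repeat match goal with |- context [Rle_dec ?u ?v] => destruct (Rle_dec u v) end;
    unfold Rabs; repeat destruct (Rcase_abs _); lra.
Qed.

Lemma continuous_clamp (f : R -> R) (a b x : R) :
  a <= b -> continuous_on (fun r => a <= r <= b) f ->
  continuous (fun y => f (clamp a b y)) x.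
Proof.
  intros Hab Hf. unfold continuous.
  apply (filterlim_comp _ _ _ (clamp a b) f _
           (within (fun r => a <= r <= b) (locally (clamp a b x)))).
  - intros P [d Hd]. exists d. intros y Hy.
    apply Hd; [|now apply clamp_in].
    apply Rle_lt_trans with (1 := clamp_lipschitz a b x y). exact Hy.
  - apply Hf. now apply clamp_in.
Qed.

Lemma clamp_locally_id (f : R -> R) (a b x : R) :
  a < x < b -> locally x (fun y => f (clamp a b y) = f y).
Proof.
  intros Hx. apply (locally_interval _ x a b); simpl; try lra.
  intros y Hy1 Hy2. rewrite clamp_id; [reflexivity|lra].
Qed.

Lemma Derive_clamp (f : R -> R) (a b x : R) :
  a < x < b -> Derive (fun y => f (clamp a b y)) x = Derive f x.
Proof. intros Hx. apply Derive_ext_loc. now apply clamp_locally_id. Qed.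

Lemma smooth_on_of_is_derive (f df : R -> R) (a b : R) :
  (forall x, a <= x <= b -> is_derive f x (df x) /\ continuous df x) ->
  smooth_on a b f.
Proof.
  intros H. split.
  - intros x Hx. split; [exists (df x); apply H; lra|].
    apply (continuous_ext_loc _ df); [|apply H; lra].
    apply (locally_interval _ x a b); simpl; try lra.
    intros y Hy1 Hy2. symmetry. apply is_derive_unique, H. lra.
  - intros x Hx. destruct (H x Hx) as [Hd _].
    apply (filterlim_filter_le_1 f (filter_le_within _)).
    apply (ex_derive_continuous f x). now exists (df x).
Qed.

(** * The radius as a function of the density *)

Section Profile.

Context (e K B k1 k2 : R).
Context (he : 0 < e) (hK : 0 < K) (hk1 : 0 < k1).

(** Half the squared speed at density [x], by Bernoulli's law. *)
Definition kinetic (x : R) : R := B - K * Rpower x e.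

Definition radius_sqr (x : R) : R := (k1 ^ 2 / x ^ 2 + k2 ^ 2) / (2 * kinetic x).

(** A positive multiple of the difference [c ^ 2 - U1 ^ 2] at density [x]
    (see [margin_sound_speed]), arranged so that it is increasing in [x]. *)
Definition margin (x : R) : R :=
  e * K * Rpower x e * (k1 ^ 2 + k2 ^ 2 * x ^ 2) - 2 * k1 ^ 2 * kinetic x.

Definition dradius_sqr (x : R) : R :=
  2 * margin x / (x ^ 3 * (2 * kinetic x) ^ 2).

Lemma Rpower_pos (x y : R) : 0 < Rpower x y.
Proof. apply exp_pos. Qed.

Lemma kinetic_decr (x y : R) : 0 < x < y -> kinetic y < kinetic x.
Proof.
  intros H. unfold kinetic.
  assert (Rpower x e < Rpower y e) by now apply Rlt_Rpower_l. nra.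
Qed.

Lemma is_derive_kinetic (x : R) :
  0 < x -> is_derive kinetic x (- (K * (e * Rpower x e / x))).
Proof.
  intros Hx. unfold kinetic, Rpower. auto_derive; [assumption|]. field. lra.
Qed.

Lemma is_derive_radius_sqr (x : R) :
  0 < x -> 0 < kinetic x -> is_derive radius_sqr x (dradius_sqr x).
Proof.
  intros Hx Hk.
  assert (Hd := is_derive_kinetic x Hx).
  unfold radius_sqr.
  auto_derive.
  - repeat split; try nra. now exists (- (K * (e * Rpower x e / x))).
  - rewrite (is_derive_unique (fun t : R => kinetic t) x _ Hd). unfold dradius_sqr, margin. field.
    split; lra.
Qed.

Lemma margin_incr (x y : R) : 0 < x < y -> margin x < margin y.
Proof.
  intros H. assert (Hk := kinetic_decr x y H). unfold margin.
  assert (HR : Rpower x e < Rpower y e) by now apply Rlt_Rpower_l.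
  assert (H0 := Rpower_pos x e).
  assert (0 < e * K) by nra.
  assert (e * K * Rpower x e <= e * K * Rpower y e)
    by (apply Rmult_le_compat_l; lra).
  assert (0 <= k2 ^ 2) by apply pow2_ge_0.
  assert (x ^ 2 <= y ^ 2) by nra.
  assert (k1 ^ 2 + k2 ^ 2 * x ^ 2 <= k1 ^ 2 + k2 ^ 2 * y ^ 2)
    by (apply Rplus_le_compat_l, Rmult_le_compat_l; assumption).
  assert (0 < k1 ^ 2) by now apply pow_lt.
  assert (0 <= e * K * Rpower x e) by (apply Rmult_le_pos; lra).
  assert (0 <= k1 ^ 2 + k2 ^ 2 * x ^ 2).
  { apply Rplus_le_le_0_compat; [lra|]. apply Rmult_le_pos; [lra|apply pow2_ge_0]. }
  assert (e * K * Rpower x e * (k1 ^ 2 + k2 ^ 2 * x ^ 2)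
          <= e * K * Rpower y e * (k1 ^ 2 + k2 ^ 2 * y ^ 2))
    by now apply Rmult_le_compat.
  nra.
Qed.

Lemma ex_derive_margin (x : R) : 0 < x -> ex_derive margin x.
Proof.
  intros Hx. unfold margin.
  auto_derive. repeat split.
  - eexists. now apply is_derive_Rpower.
  - eexists. now apply is_derive_kinetic.
Qed.

Lemma dradius_sqr_sign (s x : R) :
  0 < x -> 0 < kinetic x -> 0 < s * margin x -> 0 < s * dradius_sqr x.
Proof.
  intros Hx Hk Hs. unfold dradius_sqr.
  replace (s * _) with (s * margin x * (2 / (x ^ 3 * (2 * kinetic x) ^ 2)))
    by (field; lra).
  apply Rmult_lt_0_compat; [exact Hs|].
  apply Rdiv_lt_0_compat; [lra|].
  apply Rmult_lt_0_compat; apply pow_lt; lra.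
Qed.

(** The margin increases, so its sign at the left end and that of [kinetic] at
    the right end control the derivative on the whole interval. *)
Lemma radius_sqr_incr (x y : R) :
  0 < x < y -> 0 < kinetic y -> 0 < margin x -> radius_sqr x < radius_sqr y.
Proof.
  intros Hxy Hk Hm.
  assert (Hpos : forall z, x <= z <= y -> 0 < kinetic z /\ 0 < margin z).
  { intros z Hz. split.
    - destruct (Req_dec z y) as [->|]; [assumption|].
      assert (kinetic y < kinetic z) by (apply kinetic_decr; lra). lra.
    - destruct (Req_dec z x) as [->|]; [assumption|].
      assert (margin x < margin z) by (apply margin_incr; lra). lra. }
  apply (incr_function_le radius_sqr x y dradius_sqr); simpl; try lra.
  - intros z H1 H2. apply is_derive_radius_sqr; [lra|]. apply Hpos. lra.
  - intros z H1 H2. rewrite <- (Rmult_1_l (dradius_sqr z)).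
    destruct (Hpos z); [lra|]. apply dradius_sqr_sign; lra.
Qed.

(** The mass flux [r * x * U1 = k1] is fixed and the speed is bounded by
    Bernoulli's law, so a small density [x] forces a large radius. *)
Lemma radius_sqr_large_at_vacuum (x M : R) :
  0 < x -> 0 < kinetic x -> exists y, 0 < y < x /\ M < radius_sqr y.
Proof.
  intros Hx Hk.
  assert (HB : 0 < B).
  { assert (H := Rpower_pos x e). unfold kinetic in Hk. nra. }
  assert (Hk2 : 0 < k1 ^ 2) by nra.
  (* [t] is chosen so that [k1 ^ 2 / y ^ 2 = k1 ^ 2 * (1 + t) ^ 2 / x ^ 2]
     exceeds [2 * B * M], and [kinetic] never exceeds [B]. *)
  set (t := 1 + 2 * B * Rabs M * x ^ 2 / k1 ^ 2).
  assert (HM := Rabs_pos M). assert (HM' := Rle_abs M).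
  assert (Ht : 1 <= t).
  { unfold t. assert (0 <= 2 * B * Rabs M * x ^ 2 / k1 ^ 2); [|lra].
    apply Rcomplements.Rdiv_le_0_compat; [|assumption].
    repeat apply Rmult_le_pos; nra. }
  assert (Hy : 0 < x / (1 + t) < x).
  { split; [apply Rdiv_lt_0_compat; lra|].
    apply Rmult_lt_reg_r with (1 + t); [lra|].
    replace (x / (1 + t) * (1 + t)) with x by (field; lra). nra. }
  exists (x / (1 + t)). split; [exact Hy|].
  assert (Hky : kinetic x < kinetic (x / (1 + t))) by now apply kinetic_decr.
  assert (HkB : kinetic (x / (1 + t)) <= B).
  { unfold kinetic. assert (H := Rpower_pos (x / (1 + t)) e). nra. }
  unfold radius_sqr.
  apply Rmult_lt_reg_r with (2 * kinetic (x / (1 + t))); [lra|].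
  replace (_ / (2 * kinetic (x / (1 + t))) * (2 * kinetic (x / (1 + t))))
    with (k1 ^ 2 / (x / (1 + t)) ^ 2 + k2 ^ 2) by (field; lra).
  replace (k1 ^ 2 / (x / (1 + t)) ^ 2) with (k1 ^ 2 / x ^ 2 * (1 + t) ^ 2)
    by (field; lra).
  assert (Hv : 0 < k1 ^ 2 / x ^ 2) by (apply Rdiv_lt_0_compat; nra).
  assert (Hvt : k1 ^ 2 / x ^ 2 * t = k1 ^ 2 / x ^ 2 + 2 * B * Rabs M)
    by (unfold t; field; lra).
  assert (k1 ^ 2 / x ^ 2 * t <= k1 ^ 2 / x ^ 2 * (1 + t) ^ 2)
    by (apply Rmult_le_compat_l; nra).
  assert (M * (2 * kinetic (x / (1 + t))) <= 2 * B * Rabs M) by nra.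
  nra.
Qed.

(** At the stagnation density, the zero of [kinetic], the denominator of
    [radius_sqr] vanishes but its numerator does not. *)
Lemma radius_sqr_large_at_stagnation (x M : R) :
  0 < x -> 0 < kinetic x ->
  exists y, x < y /\ 0 < kinetic y /\ M < radius_sqr y.
Proof.
  intros Hx Hk.
  assert (HR := Rpower_pos x e).
  assert (HB : 0 < B) by (unfold kinetic in Hk; nra).
  set (xm := Rpower (B / K) (/ e)).
  assert (HBK : 0 < B / K) by now apply Rdiv_lt_0_compat.
  assert (Hxm0 : 0 < xm) by apply Rpower_pos.
  assert (Hxm : kinetic xm = 0).
  { unfold kinetic, xm. rewrite Rpower_mult, Rinv_l, Rpower_1 by lra. field. lra. }
  assert (Hlt : x < xm).
  { destruct (Rtotal_order x xm) as [|[E|E]]; [assumption| |].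
    - rewrite E in Hk. lra.
    - assert (kinetic x < kinetic xm) by (apply kinetic_decr; lra). lra. }
  set (N := fun y => k1 ^ 2 / y ^ 2 - 2 * M * kinetic y).
  assert (HNc : continuous N xm).
  { apply (ex_derive_continuous N xm). unfold N. auto_derive.
    repeat split; [nra|]. eexists. now apply is_derive_kinetic. }
  destruct (continuous_pos N xm HNc) as [d [Hd HN]].
  { unfold N. rewrite Hxm, Rmult_0_r, Rminus_0_r. apply Rdiv_lt_0_compat; nra. }
  set (y := Rmax ((x + xm) / 2) (xm - d / 2)).
  assert (Hy : (x + xm) / 2 <= y /\ xm - d / 2 <= y /\ y < xm).
  { unfold y. split; [apply Rmax_l|split; [apply Rmax_r|]].
    apply Rmax_lub_lt; lra. }
  assert (Hky : 0 < kinetic y) by (rewrite <- Hxm; apply kinetic_decr; lra).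
  exists y. split; [lra|split; [exact Hky|]].
  assert (HNy : 0 < N y).
  { apply HN. rewrite Rabs_minus_sym, Rabs_pos_eq; lra. }
  unfold N in HNy. unfold radius_sqr.
  apply Rmult_lt_reg_r with (2 * kinetic y); [lra|].
  replace (_ / (2 * kinetic y) * (2 * kinetic y)) with (k1 ^ 2 / y ^ 2 + k2 ^ 2)
    by (field; lra).
  nra.
Qed.

(** A margin of constant sign near [x0] gives a monotone branch of
    [radius_sqr] through [x0].  The sign [s] decides on which side of [x0] the
    branch climbs to arbitrarily large radii: towards the stagnation density
    for [s > 0], towards vacuum for [s < 0].  Only a small excursion is made on
    the other side, to make [x0] interior. *)
Lemma monotone_branch (x0 M : R) :
  0 < x0 -> 0 < kinetic x0 -> margin x0 <> 0 ->
  let s := margin x0 in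
  exists a b, 0 < a < x0 /\ x0 < b /\
    (forall x, a <= x <= b -> 0 < kinetic x /\ 0 < s * margin x) /\
    forall y, radius_sqr x0 <= y <= M ->
      s * radius_sqr a < s * y < s * radius_sqr b.
Proof.
  intros Hx Hk Hm s.
  destruct (continuous_pos (fun x => s * margin x) x0) as [d1 [Hd1 H1]].
  { apply (continuous_scal_r s margin), (ex_derive_continuous margin x0).
    now apply ex_derive_margin. }
  { change (0 < margin x0 * margin x0). nra. }
  destruct (continuous_pos kinetic x0) as [d2 [Hd2 H2]].
  { apply (ex_derive_continuous kinetic x0). eexists. now apply is_derive_kinetic. }
  { exact Hk. }
  assert (Hbelow : forall x y, 0 < x <= y -> 0 < kinetic y -> 0 < kinetic x).
  { intros x y Hxy Hy. destruct (Req_dec x y) as [->|]; [assumption|].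
    assert (kinetic y < kinetic x) by (apply kinetic_decr; lra). lra. }
  assert (Hge : forall x y, 0 < x <= y -> margin x <= margin y).
  { intros x y Hxy. destruct (Req_dec x y) as [->|]; [lra|].
    assert (margin x < margin y) by (apply margin_incr; lra). lra. }
  destruct (Rtotal_order 0 s) as [Hs|[Hs|Hs]]; [|exfalso; now apply Hm|].
  - set (a := Rmax (x0 / 2) (x0 - d1 / 2)).
    assert (Ha : x0 / 2 <= a /\ x0 - d1 / 2 <= a /\ a < x0).
    { unfold a. split; [apply Rmax_l|split; [apply Rmax_r|]].
      apply Rmax_lub_lt; lra. }
    assert (Hma : 0 < margin a).
    { assert (0 < s * margin a); [|nra].
      apply H1. rewrite Rabs_minus_sym, Rabs_pos_eq; lra. }
    destruct (radius_sqr_large_at_stagnation x0 M Hx Hk) as [b [Hb [Hkb HMb]]].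
    exists a, b. split; [lra|split; [lra|split]].
    + intros x Hxab. split; [apply (Hbelow x b); lra|].
      apply Rmult_lt_0_compat; [exact Hs|].
      assert (margin a <= margin x) by (apply Hge; lra). lra.
    + intros y Hy.
      assert (radius_sqr a < radius_sqr x0) by (apply radius_sqr_incr; lra).
      split; apply Rmult_lt_compat_l; lra.
  - set (b := x0 + Rmin (d1 / 2) (d2 / 2)).
    assert (Hb : x0 < b /\ b <= x0 + d1 / 2 /\ b <= x0 + d2 / 2).
    { unfold b. assert (A1 := Rmin_l (d1 / 2) (d2 / 2)).
      assert (A2 := Rmin_r (d1 / 2) (d2 / 2)).
      assert (0 < Rmin (d1 / 2) (d2 / 2)) by (apply Rmin_glb_lt; lra). lra. }
    assert (Hmb : margin b < 0).
    { assert (0 < s * margin b); [|nra].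
      apply H1. rewrite Rabs_pos_eq; lra. }
    assert (Hkb : 0 < kinetic b) by (apply H2; rewrite Rabs_pos_eq; lra).
    destruct (radius_sqr_large_at_vacuum x0 M Hx Hk) as [a [Ha HMa]].
    assert (Hall : forall x, a <= x <= b -> 0 < kinetic x /\ 0 < s * margin x).
    { intros x Hxab. split; [apply (Hbelow x b); lra|].
      assert (margin x <= margin b) by (apply Hge; lra). nra. }
    exists a, b. split; [lra|split; [lra|split; [exact Hall|]]].
    intros y Hy.
    assert (- radius_sqr x0 < - radius_sqr b).
    { apply (incr_function_le (fun x => - radius_sqr x) x0 b (fun x => - dradius_sqr x));
        simpl; try lra.
      - intros z Hz1 Hz2. apply (is_derive_opp radius_sqr).
        destruct (Hall z); [lra|]. apply is_derive_radius_sqr; lra.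
      - intros z Hz1 Hz2. destruct (Hall z) as [Hz3 Hz4]; [lra|].
        assert (0 < s * dradius_sqr z) by (apply dradius_sqr_sign; lra). nra. }
    nra.
Qed.

(** The density solving [radius_sqr (q r) = r ^ 2] with [q r0 = x0] is the
    inverse of a monotone branch.  A continuous competitor [p] starting from
    [x0] cannot leave the branch: to do so it would take the value [a] or [b]
    at some radius, but no radius of [r0, r1] is attained there.  The second
    derivative is provided for the sake of [C ^ 1] regularity. *)
Lemma density_branch (x0 r0 r1 : R) :
  0 < r0 < r1 -> 0 < x0 -> 0 < kinetic x0 -> margin x0 <> 0 ->
  radius_sqr x0 = r0 ^ 2 ->
  exists q dq, q r0 = x0 /\
    (forall r, r0 <= r <= r1 ->
       locally r (fun t => 0 < q t /\ 0 < kinetic (q t) /\ radius_sqr (q t) = t ^ 2)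
       /\ is_derive q r (dq r) /\ ex_derive dq r /\ 0 < margin x0 * margin (q r)) /\
    (forall p, continuity p -> p r0 = x0 ->
       (forall r, r0 <= r <= r1 -> radius_sqr (p r) = r ^ 2) ->
       forall r, r0 <= r <= r1 -> p r = q r).
Proof.
  intros Hr Hx Hk Hm Hx0.
  destruct (monotone_branch x0 (r1 ^ 2) Hx Hk Hm) as [a [b [Ha [Hb [Hpos Hrng]]]]].
  set (s := margin x0) in *.
  destruct (inverse_branch radius_sqr dradius_sqr s a b) as [phi Hphi].
  { lra. }
  { intros x Hxab. destruct (Hpos x Hxab). apply is_derive_radius_sqr; lra. }
  { intros x Hxab. destruct (Hpos x Hxab). apply dradius_sqr_sign; lra. }
  assert (Hmem : forall r, r0 <= r <= r1 ->
            s * radius_sqr a < s * r ^ 2 < s * radius_sqr b).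
  { intros r Hrr. apply Hrng. rewrite Hx0. split; nra. }
  assert (Hmono : forall x y, a <= x -> x < y -> y <= b ->
            s * radius_sqr x < s * radius_sqr y).
  { intros x y H1 H2 H3.
    apply (incr_function_le (fun z => s * radius_sqr z) a b
             (fun z => s * dradius_sqr z)); simpl; try lra.
    - intros z Hz1 Hz2. apply is_derive_scal.
      destruct (Hpos z); [lra|]. apply is_derive_radius_sqr; lra.
    - intros z Hz1 Hz2. destruct (Hpos z); [lra|].
      apply dradius_sqr_sign; lra. }
  assert (Hinj : forall x y, a < x < b -> a < y < b ->
            radius_sqr x = radius_sqr y -> x = y).
  { intros x y H1 H2 H3. destruct (Rtotal_order x y) as [H|[H|H]]; [|exact H|].
    - assert (s * radius_sqr x < s * radius_sqr y) by (apply Hmono; lra).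
      rewrite H3 in *. lra.
    - assert (s * radius_sqr y < s * radius_sqr x) by (apply Hmono; lra).
      rewrite H3 in *. lra. }
  assert (Hq0 : phi (r0 ^ 2) = x0).
  { destruct (Hphi (r0 ^ 2)) as [Hin [Heq _]]; [apply Hmem; lra|].
    apply Hinj; [exact Hin|lra|congruence]. }
  exists (fun r => phi (r ^ 2)).
  exists (fun r => 2 * r / dradius_sqr (phi (r ^ 2))).
  split; [exact Hq0|split].
  - intros r Hrr.
    assert (Hder : forall t, s * radius_sqr a < s * t ^ 2 < s * radius_sqr b ->
              is_derive (fun t => phi (t ^ 2)) t (2 * t / dradius_sqr (phi (t ^ 2)))).
    { intros t Ht. destruct (Hphi (t ^ 2) Ht) as [_ [_ Hd]].
      unfold Rdiv. apply (is_derive_comp phi (fun t => t ^ 2) t _ (2 * t) Hd).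
      auto_derive; [trivial|ring]. }
    destruct (Hphi (r ^ 2) (Hmem r Hrr)) as [Hin _].
    destruct (Hpos (phi (r ^ 2))) as [Hp1 Hp2]; [lra|].
    split; [|split; [now apply Hder, Hmem|split; [|exact Hp2]]].
    + assert (Hloc : locally r (fun t =>
                s * radius_sqr a < s * t ^ 2 < s * radius_sqr b)).
      { assert (Hc : continuous (fun t => s * t ^ 2) r)
          by (apply (ex_derive_continuous (fun t => s * t ^ 2) r); now auto_derive).
        apply (Hc (fun y => s * radius_sqr a < y < s * radius_sqr b)).
        apply (locally_interval _ _ (s * radius_sqr a) (s * radius_sqr b));
          try apply Hmem; simpl; auto. }
      apply filter_imp with (2 := Hloc). intros t Ht.
      destruct (Hphi (t ^ 2) Ht) as [Ht1 [Ht2 _]].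
      destruct (Hpos (phi (t ^ 2))) as [Ht3 _]; [lra|].
      split; [lra|split; [exact Ht3|exact Ht2]].
    + set (q := fun r => phi (r ^ 2)) in *.
      assert (Hqd : ex_derive q r) by (eexists; now apply Hder, Hmem).
      change (ex_derive (fun r => 2 * r / dradius_sqr (q r)) r).
      change (phi (r ^ 2)) with (q r) in *.
      assert (Hmq : margin (q r) <> 0) by (intros E; rewrite E in Hp2; lra).
      assert (Hexm : ex_derive (fun t => margin (q t)) r)
        by (apply (ex_derive_comp margin q); [apply ex_derive_margin; lra|exact Hqd]).
      assert (Hexk : ex_derive (fun t => kinetic (q t)) r).
      { apply (ex_derive_comp kinetic q); [|exact Hqd].
        eexists. apply is_derive_kinetic. lra. }
      set (mq := fun t => margin (q t)) in *. set (kq := fun t => kinetic (q t)) in *.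
      unfold dradius_sqr.
      change (ex_derive (fun r => 2 * r / (2 * mq r / (q r ^ 3 * (2 * kq r) ^ 2))) r).
      assert (Hkq : 0 < kq r) by exact Hp1.
      assert (Hd0 : q r ^ 3 * (2 * kq r) ^ 2 <> 0).
      { apply Rgt_not_eq, Rmult_lt_0_compat; apply pow_lt; lra. }
      auto_derive. repeat split; try assumption.
      apply Rmult_integral_contrapositive_currified.
      * apply Rmult_integral_contrapositive_currified; [lra|exact Hmq].
      * apply Rinv_neq_0_compat. exact Hd0.
  - intros p Hpc Hp0 Hpr.
    assert (Hstay : forall r, r0 <= r <= r1 -> a < p r < b).
    { intros r Hrr.
      assert (Hhit : forall v, radius_sqr v = radius_sqr a \/ radius_sqr v = radius_sqr b ->
                ~ (Rmin (p r0) (p r) <= v <= Rmax (p r0) (p r))).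
      { intros v Hv Hv'. destruct (IVT_gen p r0 r v Hpc Hv') as [t [Ht1 Ht2]].
        rewrite Rmin_left, Rmax_right in Ht1 by lra.
        assert (Ht : r0 <= t <= r1) by lra.
        assert (A1 := Hmem t Ht). assert (A2 := Hpr t Ht). rewrite Ht2 in A2.
        rewrite <- A2 in A1. destruct Hv as [Hv|Hv]; rewrite Hv in A1; lra. }
      rewrite Hp0 in Hhit.
      split.
      - destruct (Rlt_le_dec a (p r)) as [|Hle]; [assumption|exfalso].
        apply (Hhit a); [now left|]. rewrite Rmin_right, Rmax_left; lra.
      - destruct (Rlt_le_dec (p r) b) as [|Hle]; [assumption|exfalso].
        apply (Hhit b); [now right|]. rewrite Rmin_left, Rmax_right; lra. }
    intros r Hrr.
    destruct (Hphi (r ^ 2) (Hmem r Hrr)) as [Hin [Heq _]].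
    apply Hinj; [now apply Hstay|exact Hin|]. rewrite Heq. now apply Hpr.
Qed.

End Profile.

(** * First integrals of the Euler system *)

Lemma sound_speed_sqr_Rpower (g d a : R) :
  0 < d -> sound_speed_sqr g d a = g * a * Rpower d (g - 1).
Proof.
  intros Hd. unfold sound_speed_sqr, pressure.
  rewrite (Rpower_minus_1 d g Hd). field. lra.
Qed.

Definition clamp_flow (a b : R) (S : flow) : flow :=
  Flow (fun r => U1 S (clamp a b r)) (fun r => U2 S (clamp a b r))
       (fun r => rho S (clamp a b r)) (fun r => A S (clamp a b r)).

Lemma euler_at_clamp_flow (g a b r : R) (S : flow) :
  a < r < b -> euler_at g S r -> euler_at g (clamp_flow a b S) r.
Proof.
  intros Hr. unfold euler_at, clamp_flow; simpl U1; simpl U2; simpl rho; simpl A.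
  rewrite (Derive_clamp (fun s => rho S s * U1 S s) a b r Hr).
  rewrite (Derive_clamp (U1 S) a b r Hr), (Derive_clamp (U2 S) a b r Hr).
  rewrite (Derive_clamp (A S) a b r Hr).
  rewrite (Derive_clamp (fun s => pressure g (rho S s) (A S s)) a b r Hr).
  now rewrite clamp_id by lra.
Qed.

Lemma exists_unique_flow_of_solution
    (a b : R) (P Q : flow -> Prop) (S : flow) :
  P S -> (forall T, P T -> flow_eq_on a b S T) -> Q S ->
  exists_unique_flow a b (fun T => P T /\ Q T).
Proof.
  intros HP Hu HQ. exists S. split; [now split|]. intros T [HT _]. now apply Hu.
Qed.

Section Flow.

Context (gamma r0 r1 rho0 A0 U10 U20 : R).
Context (hgamma : 1 < gamma) (hr0 : 0 < r0) (hr01 : r0 < r1)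
        (hrho0 : 0 < rho0) (hA0 : 0 < A0) (hU10 : 0 < U10).

Local Notation k1 := (kappa1 r0 rho0 U10).
Local Notation k2 := (kappa2 r0 U20).
Local Notation K := (gamma * A0 / (gamma - 1)).
Local Notation B := (B0 gamma rho0 A0 U10 U20).
Local Notation kin := (kinetic (gamma - 1) K B).
Local Notation rsq := (radius_sqr (gamma - 1) K B k1 k2).
Local Notation mar := (margin (gamma - 1) K B k1 k2).

Lemma kappa1_pos : 0 < k1.
Proof. unfold kappa1. repeat apply Rmult_lt_0_compat; assumption. Qed.

Lemma K_pos : 0 < K.
Proof. apply Rdiv_lt_0_compat; [apply Rmult_lt_0_compat|]; lra. Qed.

(** Mass conservation keeps [U1] away from zero, so that the last two equations
    can be divided by [U1]; the entropy is then constant and the momentum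
    equation becomes the derivative of Bernoulli's law. *)
Lemma first_integrals_of_continuous (S : flow) :
  (forall r, continuous (U1 S) r /\ continuous (U2 S) r /\
             continuous (rho S) r /\ continuous (A S) r) ->
  (forall r, r0 < r < r1 -> ex_derive (U1 S) r /\ ex_derive (U2 S) r /\
             ex_derive (rho S) r /\ ex_derive (A S) r) ->
  (forall r, r0 <= r <= r1 -> 0 < rho S r) ->
  (forall r, r0 < r < r1 -> euler_at gamma S r) ->
  rho S r0 = rho0 -> U1 S r0 = U10 -> U2 S r0 = U20 -> A S r0 = A0 ->
  forall r, r0 <= r <= r1 ->
    r * rho S r * U1 S r = k1 /\ r * U2 S r = k2 /\ A S r = A0 /\
    1 / 2 * (U1 S r ^ 2 + U2 S r ^ 2) + K * Rpower (rho S r) (gamma - 1) = B.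
Proof.
  intros Hc Hd Hpos He I1 I2 I3 I4.
  assert (Hmass : forall r, r0 <= r <= r1 -> r * rho S r * U1 S r = k1).
  { intros r Hr. unfold kappa1. rewrite <- I1, <- I2.
    apply (constant_of_zero_derive (fun r => r * rho S r * U1 S r) r0 r1);
      [| |exact Hr]; clear r Hr; intros r Hr.
    - destruct (Hc r) as [H1 [_ [H3 _]]].
      apply (continuous_Rmult (fun r => r * rho S r)); [|exact H1].
      apply (continuous_Rmult (fun r => r)); [apply continuous_id|exact H3].
    - destruct (Hd r Hr) as [H1 [_ [H3 _]]]. destruct (He r Hr) as [E1 _].
      rewrite Derive_mult in E1 by assumption.
      auto_derive; [now repeat split|].
      match goal with |- ?l = 0 => replace l with
        (r * (Derive (rho S) r * U1 S r + rho S r * Derive (U1 S) r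
              + 1 / r * (rho S r * U1 S r))) end.
      + rewrite E1. ring.
      + change (Derive (fun x => rho S x) r) with (Derive (rho S) r).
        change (Derive (fun x => U1 S x) r) with (Derive (U1 S) r).
        field. lra. }
  assert (HU1 : forall r, r0 <= r <= r1 -> U1 S r <> 0).
  { intros r Hr E. assert (H := Hmass r Hr). rewrite E, Rmult_0_r in H.
    assert (H' := kappa1_pos). lra. }
  assert (HdU2 : forall r, r0 < r < r1 -> Derive (U2 S) r = - U2 S r / r).
  { intros r Hr. destruct (He r Hr) as [_ [_ [E3 _]]].
    apply Rmult_eq_reg_l with (U1 S r); [|apply HU1; lra].
    unfold Rdiv in *. lra. }
  assert (HdA : forall r, r0 < r < r1 -> Derive (A S) r = 0).
  { intros r Hr. destruct (He r Hr) as [_ [_ [_ E4]]].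
    apply Rmult_integral in E4. destruct E4 as [E4|E4]; [|exact E4].
    exfalso. apply (HU1 r); [lra|exact E4]. }
  assert (HA : forall r, r0 <= r <= r1 -> A S r = A0).
  { intros r Hr. rewrite <- I4.
    apply (constant_of_zero_derive (A S) r0 r1); [| |exact Hr];
      clear r Hr; intros r Hr.
    - apply Hc.
    - rewrite <- (HdA r Hr). apply Derive_correct. now apply Hd. }
  intros r Hr. split; [now apply Hmass|split; [|split; [now apply HA|]]].
  - unfold kappa2. rewrite <- I3.
    apply (constant_of_zero_derive (fun r => r * U2 S r) r0 r1);
      [| |exact Hr]; clear r Hr; intros r Hr.
    + apply (continuous_Rmult (fun r => r)); [apply continuous_id|apply Hc].
    + destruct (Hd r Hr) as [_ [H2 _]].
      auto_derive; [now repeat split|].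
      change (Derive (fun x => U2 S x) r) with (Derive (U2 S) r).
      rewrite (HdU2 r Hr). field. lra.
  - set (E := fun r => 1 / 2 * (U1 S r ^ 2 + U2 S r ^ 2)
                       + K * Rpower (rho S r) (gamma - 1)).
    change (E r = B). replace B with (E r0)
      by (unfold E, B0; now rewrite I1, I2, I3).
    apply (constant_of_zero_derive E r0 r1); [| |exact Hr];
      clear r Hr; intros r Hr.
    + destruct (Hc r) as [H1 [H2 [H3 _]]].
      unfold E. simpl pow.
      assert (HR : continuous (fun r => Rpower (rho S r) (gamma - 1)) r).
      { apply (continuous_comp (rho S) (fun y => Rpower y (gamma - 1))); [exact H3|].
        apply (ex_derive_continuous (fun y => Rpower y (gamma - 1))).
        eexists. now apply is_derive_Rpower, Hpos. }
      repeat first [ exact H1 | exact H2 | exact HR | apply continuous_const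
                   | apply continuous_Rplus | apply continuous_Rmult ].
    + destruct (Hd r Hr) as [H1 [H2 [H3 H4]]].
      assert (Hrho : 0 < rho S r) by (apply Hpos; lra).
      assert (HR : is_derive (fun s : R => Rpower (rho S s) (gamma - 1)) r
        (Derive (rho S) r * ((gamma - 1) * Rpower (rho S r) (gamma - 1) / rho S r))).
      { apply (is_derive_comp (fun y => Rpower y (gamma - 1)) (rho S)).
        - now apply is_derive_Rpower.
        - now apply Derive_correct. }
      assert (HP : is_derive (fun s : R => pressure gamma (rho S s) (A S s)) r
        (A0 * (Derive (rho S) r * (gamma * Rpower (rho S r) gamma / rho S r)))).
      { unfold pressure.
        assert (HR' : is_derive (fun s : R => Rpower (rho S s) gamma) r
          (Derive (rho S) r * (gamma * Rpower (rho S r) gamma / rho S r))).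
        { apply (is_derive_comp (fun y => Rpower y gamma) (rho S)).
          - now apply is_derive_Rpower.
          - now apply Derive_correct. }
        apply (is_derive_ext_loc (fun s => A0 * Rpower (rho S s) gamma)).
        - apply (locally_interval _ r r0 r1); simpl; try lra.
          intros y Hy1 Hy2. rewrite HA by lra. reflexivity.
        - now apply is_derive_scal. }
      destruct (He r Hr) as [_ [E2 _]].
      rewrite (is_derive_unique _ _ _ HP) in E2.
      rewrite (Rpower_minus_1 (rho S r) gamma Hrho) in E2.
      assert (HDR := is_derive_unique _ _ _ HR).
      unfold E.
      set (P := fun s => Rpower (rho S s) (gamma - 1)) in *.
      assert (HPd : ex_derive P r) by (eexists; exact HR).
      apply (is_derive_ext (fun s => 1 / 2 * (U1 S s ^ 2 + U2 S s ^ 2) + K * P s));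
        [reflexivity|].
      auto_derive; [now repeat split|].
      change (Derive (fun x => U1 S x) r) with (Derive (U1 S) r).
      change (Derive (fun x => U2 S x) r) with (Derive (U2 S) r).
      change (Derive (fun x => P x) r) with (Derive P r).
      rewrite HDR, (HdU2 r Hr), <- E2. fold (P r). field. repeat split; lra.
Qed.

Lemma first_integrals (S : flow) :
  smooth_solution gamma r0 r1 rho0 A0 U10 U20 S ->
  forall r, r0 <= r <= r1 ->
    r * rho S r * U1 S r = k1 /\ r * U2 S r = k2 /\ A S r = A0 /\
    1 / 2 * (U1 S r ^ 2 + U2 S r ^ 2) + K * Rpower (rho S r) (gamma - 1) = B.
Proof.
  intros [[[D1 C1] [[D2 C2] [[D3 C3] [D4 C4]]]] [Hpos [He [I1 [I2 [I3 I4]]]]]].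
  intros r Hr.
  assert (Hex : forall (f : R -> R) t, r0 < t < r1 -> ex_derive f t ->
            ex_derive (fun s => f (clamp r0 r1 s)) t).
  { intros f t Ht Hf. apply ex_derive_ext_loc with (2 := Hf).
    apply filter_imp with (2 := clamp_locally_id f r0 r1 t Ht). now intros. }
  assert (H : forall t, r0 <= t <= r1 -> clamp r0 r1 t = t) by apply clamp_id.
  assert (H0 := H r0 ltac:(lra)).
  assert (HF := first_integrals_of_continuous (clamp_flow r0 r1 S)).
  cbn [clamp_flow U1 U2 rho A] in HF. rewrite H0 in HF.
  specialize (fun a b c d => HF a b c d I1 I2 I3 I4 r Hr). rewrite (H r Hr) in HF.
  apply HF.
  - intros t. repeat split; apply continuous_clamp; assumption || lra.
  - intros t Ht. repeat split; apply Hex; try assumption;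
      [apply D1|apply D2|apply D3|apply D4]; exact Ht.
  - intros t Ht. rewrite (H t Ht). now apply Hpos.
  - intros t Ht. apply euler_at_clamp_flow; [exact Ht|now apply He].
Qed.

(** Eliminating the velocity between the first integrals leaves the radius as
    an explicit function of the density. *)
Lemma radius_sqr_density (S : flow) :
  smooth_solution gamma r0 r1 rho0 A0 U10 U20 S ->
  forall r, r0 <= r <= r1 ->
    0 < rho S r /\ 0 < kin (rho S r) /\ rsq (rho S r) = r ^ 2 /\
    speed_sqr (U1 S r) (U2 S r) = 2 * kin (rho S r).
Proof.
  intros HS r Hr.
  destruct (first_integrals S HS r Hr) as [H1 [H2 [H3 H4]]].
  assert (Hrho : 0 < rho S r) by now apply HS.
  assert (Hk := kappa1_pos).
  assert (HU : U1 S r <> 0) by (intros E; rewrite E, Rmult_0_r in H1; lra).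
  assert (Hkin : 2 * kin (rho S r) = U1 S r ^ 2 + U2 S r ^ 2)
    by (unfold kinetic; lra).
  assert (Hsq : 0 < U1 S r ^ 2) by now apply pow2_gt_0.
  assert (Hsq2 := pow2_ge_0 (U2 S r)).
  split; [exact Hrho|split; [lra|split]].
  - unfold radius_sqr. rewrite Hkin, <- H1, <- H2. field. split; nra.
  - unfold speed_sqr. lra.
Qed.

(** The normalizing factor is the one that clears denominators:
    [k1 ^ 2 + k2 ^ 2 * d ^ 2] is [d ^ 2 * r ^ 2] times the squared speed. *)
Lemma margin_sound_speed (r d u1 : R) :
  0 < r -> 0 < d -> 0 < kin d -> rsq d = r ^ 2 -> r * d * u1 = k1 ->
  mar d = (k1 ^ 2 + k2 ^ 2 * d ^ 2) * (sound_speed_sqr gamma d A0 - u1 ^ 2).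
Proof.
  intros Hr Hd Hkin Hrsq Hmass.
  rewrite (sound_speed_sqr_Rpower _ _ _ Hd).
  assert (Hk := kappa1_pos).
  assert (HK2 : k1 ^ 2 + k2 ^ 2 * d ^ 2 = 2 * kin d * r ^ 2 * d ^ 2).
  { rewrite <- Hrsq. unfold radius_sqr. field. lra. }
  assert (E : u1 ^ 2 * (k1 ^ 2 + k2 ^ 2 * d ^ 2) = 2 * k1 ^ 2 * kin d).
  { rewrite HK2, <- Hmass. ring. }
  unfold margin. rewrite <- E. field. lra.
Qed.

Lemma speed_minus_sound_speed (d : R) :
  0 < d ->
  2 * kin d - sound_speed_sqr gamma d A0
    = 2 * B - (gamma + 1) * K * Rpower d (gamma - 1).
Proof.
  intros Hd. rewrite (sound_speed_sqr_Rpower _ _ _ Hd).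
  unfold kinetic. field. lra.
Qed.

Lemma inflow_state :
  0 < kin rho0 /\ rsq rho0 = r0 ^ 2 /\ speed_sqr U10 U20 = 2 * kin rho0 /\
  mar rho0 = (k1 ^ 2 + k2 ^ 2 * rho0 ^ 2) * (sound_speed_sqr gamma rho0 A0 - U10 ^ 2).
Proof.
  assert (Hkin : 2 * kin rho0 = U10 ^ 2 + U20 ^ 2)
    by (unfold kinetic, B0; field; lra).
  assert (0 < U10 ^ 2) by now apply pow_lt.
  assert (H2 := pow2_ge_0 U20).
  assert (Hr : rsq rho0 = r0 ^ 2).
  { unfold radius_sqr. rewrite Hkin. unfold kappa1, kappa2. field. split; nra. }
  split; [lra|split; [exact Hr|split; [unfold speed_sqr; lra|]]].
  apply margin_sound_speed with r0; try assumption; [lra|reflexivity].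
Qed.

Lemma weight_pos (d : R) : 0 < k1 ^ 2 + k2 ^ 2 * d ^ 2.
Proof.
  assert (0 < k1 ^ 2) by (apply pow_lt, kappa1_pos).
  assert (0 <= k2 ^ 2 * d ^ 2) by (apply Rmult_le_pos; apply pow2_ge_0). lra.
Qed.

(** * Existence and uniqueness for a radially non-sonic inflow *)

Definition flow_of_density (q : R -> R) : flow :=
  Flow (fun r => k1 / (r * q r)) (fun r => k2 / r) q (fun _ => A0).

Lemma smooth_solution_of_density (q dq : R -> R) :
  q r0 = rho0 ->
  (forall r, r0 <= r <= r1 ->
     locally r (fun t => 0 < q t /\ 0 < kin (q t) /\ rsq (q t) = t ^ 2) /\
     is_derive q r (dq r) /\ ex_derive dq r) ->
  smooth_solution gamma r0 r1 rho0 A0 U10 U20 (flow_of_density q).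
Proof.
  intros Hq0 Hq.
  assert (Hqpos : forall r, r0 <= r <= r1 -> 0 < q r)
    by (intros r Hr; now destruct (locally_singleton _ _ (proj1 (Hq r Hr)))).
  assert (Hqd : forall r, r0 <= r <= r1 -> ex_derive q r)
    by (intros r Hr; exists (dq r); now apply Hq).
  assert (Hcont : forall (f : R -> R) r, ex_derive f r -> continuous f r)
    by (intros f r; apply (ex_derive_continuous f r)).
  assert (HdU1 : forall r, r0 <= r <= r1 ->
    is_derive (fun r : R => k1 / (r * q r)) r (- k1 * (q r + r * dq r) / (r * q r) ^ 2)).
  { intros r Hr. assert (Hp := Hqpos r Hr).
    assert (r * q r <> 0) by (apply Rgt_not_eq, Rmult_lt_0_compat; lra).
    auto_derive; [repeat split; auto|].
    change (Derive (fun x => q x) r) with (Derive q r).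
    rewrite (is_derive_unique q r (dq r)) by now apply Hq. field. split; lra. }
  assert (HdU2 : forall r, r0 <= r <= r1 ->
    is_derive (fun r : R => k2 / r) r (- k2 / r ^ 2)).
  { intros r Hr. auto_derive; [lra|]. field. lra. }
  split; [|split; [|split]].
  - unfold flow_of_density; simpl. split; [|split; [|split]].
    + apply smooth_on_of_is_derive
        with (fun r => - k1 * (q r + r * dq r) / (r * q r) ^ 2).
      intros r Hr. split; [now apply HdU1|apply Hcont].
      assert (Hp := Hqpos r Hr). destruct (Hq r Hr) as [_ [_ Hdd]].
      assert (Hqr : 0 < r * q r) by (apply Rmult_lt_0_compat; lra).
      auto_derive. repeat split; auto.
      apply Rgt_not_eq. rewrite Rmult_1_r. now apply Rmult_lt_0_compat.
    + apply smooth_on_of_is_derive with (fun r => - k2 / r ^ 2).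
      intros r Hr. split; [now apply HdU2|apply Hcont].
      auto_derive. nra.
    + apply smooth_on_of_is_derive with dq. intros r Hr.
      split; [now apply Hq|apply Hcont; now apply Hq].
    + apply smooth_on_of_is_derive with (fun _ => 0). intros r Hr.
      split; [now auto_derive|apply continuous_const].
  - intros r Hr. split; [now apply Hqpos|exact hA0].
  - intros r Hr'. assert (Hr : r0 <= r <= r1) by lra.
    assert (Hp := Hqpos r Hr). destruct (Hq r Hr) as [Hloc [Hdq _]].
    assert (HR : is_derive (fun s : R => Rpower (q s) (gamma - 1)) r
        (dq r * ((gamma - 1) * Rpower (q r) (gamma - 1) / q r))).
    { apply (is_derive_comp (fun y => Rpower y (gamma - 1)) q); [|exact Hdq].
      now apply is_derive_Rpower. }
    assert (HP : is_derive (fun s : R => pressure gamma (q s) A0) r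
        (A0 * (dq r * (gamma * Rpower (q r) gamma / q r)))).
    { unfold pressure. apply is_derive_scal.
      apply (is_derive_comp (fun y => Rpower y gamma) q); [|exact Hdq].
      now apply is_derive_Rpower. }
    unfold euler_at, flow_of_density; simpl U1; simpl U2; simpl rho; simpl A.
    split; [|split; [|split]].
    + rewrite (Derive_ext_loc _ (fun s : R => k1 / s)).
      * rewrite (is_derive_unique (fun s : R => k1 / s) r (- k1 / r ^ 2)).
        -- field. lra.
        -- auto_derive; [lra|]. field. lra.
      * apply (locally_interval _ r r0 r1); simpl; try lra.
        intros t Ht1 Ht2. assert (0 < q t) by (apply Hqpos; lra). field. lra.
    + (* The momentum equation is the derivative of Bernoulli's law, which
         holds on a neighbourhood of [r]. *)
      rewrite (is_derive_unique _ _ _ HP), (is_derive_unique _ _ _ (HdU1 r Hr)).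
      rewrite (Rpower_minus_1 (q r) gamma Hp).
      assert (Hbern : is_derive
        (fun s : R => (k1 / (s * q s)) ^ 2 / 2 + (k2 / s) ^ 2 / 2
                  + K * Rpower (q s) (gamma - 1)) r 0).
      { apply (is_derive_ext_loc (fun _ => B)); [|now auto_derive].
        assert (Hr_pos : locally r (fun t => 0 < t)).
        { apply (locally_interval _ r r0 r1); simpl; lra || (intros; lra). }
        generalize (filter_and _ _ Hloc Hr_pos). apply filter_imp.
        intros t [[Hq1 [Hq2 Hq3]] Ht]. change R in t.
        assert (HB : 2 * kin (q t) = (k1 ^ 2 / q t ^ 2 + k2 ^ 2) / t ^ 2).
        { rewrite <- Hq3. assert (Hw := weight_pos (q t)).
          unfold radius_sqr. field. rewrite Rpow_mult_distr.
          repeat split; apply Rgt_not_eq; assumption. }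
        replace ((k1 / (t * q t)) ^ 2 / 2 + (k2 / t) ^ 2 / 2)
          with (((k1 ^ 2 / q t ^ 2 + k2 ^ 2) / t ^ 2) / 2) by (field; lra).
        rewrite <- HB. unfold kinetic. refine (_ : @eq R _ _). field. lra. }
      set (P := fun s => Rpower (q s) (gamma - 1)) in *.
      set (V := fun s => k1 / (s * q s)) in *. set (W := fun s => k2 / s).
      assert (HV := HdU1 r Hr). assert (HW := HdU2 r Hr).
      change (is_derive W r (- k2 / r ^ 2)) in HW.
      assert (Hexp : is_derive (fun s : R => V s ^ 2 / 2 + W s ^ 2 / 2 + K * P s) r
         (V r * (- k1 * (q r + r * dq r) / (r * q r) ^ 2) + W r * (- k2 / r ^ 2)
          + K * (dq r * ((gamma - 1) * P r / q r)))).
      { auto_derive.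
        - repeat split; eexists; eassumption.
        - change (Derive (fun x => V x) r) with (Derive V r).
          change (Derive (fun x => W x) r) with (Derive W r).
          change (Derive (fun x => P x) r) with (Derive P r).
          rewrite (is_derive_unique _ _ _ HV), (is_derive_unique _ _ _ HW),
            (is_derive_unique _ _ _ HR). fold (P r). field. repeat split; lra. }
      assert (E : V r * (- k1 * (q r + r * dq r) / (r * q r) ^ 2) + W r * (- k2 / r ^ 2)
          + K * (dq r * ((gamma - 1) * P r / q r)) = 0).
      { rewrite <- (is_derive_unique _ _ _ Hexp).
        exact (is_derive_unique _ _ _ Hbern). }
      rewrite <- E. unfold V, W. fold (P r). field. repeat split; lra.
    + rewrite (is_derive_unique _ _ _ (HdU2 r Hr)). field. split; lra.
    + rewrite Derive_const. ring.
  - unfold flow_of_density; simpl. repeat split.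
    + exact Hq0.
    + rewrite Hq0. unfold kappa1. field. split; lra.
    + unfold kappa2. field. lra.
Qed.

(** The last clause records the branch on which the flow stays: through
    [margin_sound_speed], the sign of [c ^ 2 - U1 ^ 2] is that of the inflow. *)
Lemma smooth_solution_exists_unique :
  sound_speed_sqr gamma rho0 A0 <> U10 ^ 2 ->
  exists S, smooth_solution gamma r0 r1 rho0 A0 U10 U20 S /\
    (forall T, smooth_solution gamma r0 r1 rho0 A0 U10 U20 T ->
       flow_eq_on r0 r1 S T) /\
    (forall r, r0 <= r <= r1 -> 0 < mar rho0 * mar (rho S r)).
Proof.
  intros Hns.
  destruct inflow_state as [Hk [Hr0 [_ Hm]]].
  destruct (density_branch (gamma - 1) K B k1 k2 ltac:(lra) K_pos kappa1_pos
              rho0 r0 r1) as [q [dq [Hq0 [Hq Huniq]]]]; try assumption; [lra| |].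
  { rewrite Hm. apply Rmult_integral_contrapositive_currified.
    - apply Rgt_not_eq, weight_pos.
    - lra. }
  assert (HS : smooth_solution gamma r0 r1 rho0 A0 U10 U20 (flow_of_density q)).
  { apply smooth_solution_of_density with dq; [exact Hq0|].
    intros r Hr. destruct (Hq r Hr) as [H1 [H2 [H3 _]]].
    split; [exact H1|split; assumption]. }
  exists (flow_of_density q). split; [exact HS|split].
  - intros T HT.
    assert (Hrho : forall r, r0 <= r <= r1 -> rho T r = q r).
    { intros r Hr. rewrite <- (clamp_id r0 r1 r Hr) at 1.
      apply (Huniq (fun s => rho T (clamp r0 r1 s))); [| |clear r Hr|exact Hr].
      - intros t. apply continuity_pt_filterlim, continuous_clamp; [lra|].
        apply HT.
      - rewrite clamp_id by lra. apply HT.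
      - intros r Hr. rewrite clamp_id by exact Hr. now apply radius_sqr_density. }
    intros r Hr.
    destruct (first_integrals T HT r Hr) as [F1 [F2 [F3 _]]].
    assert (Hp : 0 < rho T r) by now apply HT.
    simpl. rewrite <- (Hrho r Hr), F3, <- F1, <- F2.
    repeat split; field; lra.
  - intros r Hr. now apply Hq.
Qed.

(** * The type of the flow *)

Lemma rho_c_pos : 0 < rho_c gamma rho0 A0 U10 U20.
Proof. apply exp_pos. Qed.

Lemma B_pos : 0 < B.
Proof.
  destruct inflow_state as [Hk _]. assert (H := Rpower_pos rho0 (gamma - 1)).
  assert (HK := K_pos). unfold kinetic in Hk. nra.
Qed.

Lemma rho_c_power :
  (gamma + 1) * K * Rpower (rho_c gamma rho0 A0 U10 U20) (gamma - 1) = 2 * B.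
Proof.
  assert (HB := B_pos).
  unfold rho_c. rewrite Rpower_mult.
  replace (1 / (gamma - 1) * (gamma - 1)) with 1 by (field; lra).
  rewrite Rpower_1.
  - field. repeat split; lra.
  - apply Rdiv_lt_0_compat; repeat apply Rmult_lt_0_compat; lra.
Qed.

Lemma kinetic_rho_c_pos : 0 < kin (rho_c gamma rho0 A0 U10 U20).
Proof.
  assert (HB := B_pos). assert (E := rho_c_power). unfold kinetic.
  assert (HK := K_pos).
  assert (H := Rpower_pos (rho_c gamma rho0 A0 U10 U20) (gamma - 1)).
  assert (0 < K * Rpower (rho_c gamma rho0 A0 U10 U20) (gamma - 1))
    by now apply Rmult_lt_0_compat.
  nra.
Qed.

(** At the critical density [2 * kinetic = c ^ 2], which Bernoulli's law turns
    into [2 * kinetic = 2 * (gamma - 1) * B / (gamma + 1)]; this is the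
    denominator in the definition of [r_c]. *)
Lemma r_c_sqr :
  r_c gamma r0 rho0 A0 U10 U20 ^ 2 = rsq (rho_c gamma rho0 A0 U10 U20).
Proof.
  assert (HB := B_pos). assert (Hc := rho_c_pos). assert (E := rho_c_power).
  assert (Hk := kinetic_rho_c_pos).
  unfold r_c. cbv zeta. set (c := rho_c gamma rho0 A0 U10 U20) in *.
  assert (Hkin : 2 * kin c = 2 * (gamma - 1) * B / (gamma + 1)).
  { apply Rmult_eq_reg_l with (gamma + 1); [|lra].
    transitivity (2 * (gamma + 1) * B - 2 * ((gamma + 1) * K * Rpower c (gamma - 1))).
    - unfold kinetic. ring.
    - rewrite E. field. lra. }
  rewrite pow2_sqrt.
  - unfold radius_sqr. rewrite Hkin. field. repeat split; lra.
  - apply Rlt_le, Rdiv_lt_0_compat.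
    + apply Rmult_lt_0_compat; [lra|apply weight_pos].
    + repeat apply Rmult_lt_0_compat; lra.
Qed.

(** The difference [2 * kinetic - c ^ 2] decreases in the density and [rho_c] is
    its zero. *)
Lemma type_of_density (d : R) :
  0 < d ->
  (d < rho_c gamma rho0 A0 U10 U20 <-> sound_speed_sqr gamma d A0 < 2 * kin d) /\
  (rho_c gamma rho0 A0 U10 U20 < d <-> 2 * kin d < sound_speed_sqr gamma d A0).
Proof.
  intros Hd. assert (E := rho_c_power). assert (Hc := rho_c_pos).
  assert (Hs := speed_minus_sound_speed d Hd).
  set (c := rho_c gamma rho0 A0 U10 U20) in *.
  assert (HK : 0 < (gamma + 1) * K) by (apply Rmult_lt_0_compat; [lra|apply K_pos]).
  assert (Hlt : forall x y, 0 < x -> x < y ->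
    (gamma + 1) * K * Rpower x (gamma - 1) < (gamma + 1) * K * Rpower y (gamma - 1)).
  { intros x y Hx Hxy. apply Rmult_lt_compat_l; [exact HK|].
    apply Rlt_Rpower_l; lra. }
  destruct (Rtotal_order d c) as [H|[H|H]].
  - assert (H' := Hlt d c Hd H). split; split; lra.
  - rewrite H in *. split; split; lra.
  - assert (H' := Hlt c d Hc H). split; split; lra.
Qed.

(** On the branch of positive margin [radius_sqr] is increasing, so comparing
    the density with [rho_c] is comparing the radius with [r_c]. *)
Lemma type_at_radius (S : flow) :
  smooth_solution gamma r0 r1 rho0 A0 U10 U20 S ->
  (forall r, r0 <= r <= r1 -> 0 < mar (rho S r)) ->
  0 < mar (rho_c gamma rho0 A0 U10 U20) ->
  forall r, r0 <= r <= r1 ->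
    (supersonic_at gamma S r <-> r < r_c gamma r0 rho0 A0 U10 U20) /\
    (sonic_at gamma S r <-> r = r_c gamma r0 rho0 A0 U10 U20) /\
    (subsonic_at gamma S r <-> r_c gamma r0 rho0 A0 U10 U20 < r).
Proof.
  intros HS Hm Hmc r Hr.
  destruct (radius_sqr_density S HS r Hr) as [Hd [Hk [Hrs Hsp]]].
  destruct (first_integrals S HS r Hr) as [_ [_ [HA _]]].
  destruct (type_of_density (rho S r) Hd) as [Hty1 Hty2].
  unfold supersonic_at, sonic_at, subsonic_at. rewrite Hsp, HA.
  assert (Hc := rho_c_pos). assert (Hkc := kinetic_rho_c_pos).
  assert (Hrc := r_c_sqr).
  assert (Hrc0 : 0 <= r_c gamma r0 rho0 A0 U10 U20) by apply sqrt_pos.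
  specialize (Hm r Hr).
  set (c := rho_c gamma rho0 A0 U10 U20) in *.
  set (rc := r_c gamma r0 rho0 A0 U10 U20) in *.
  assert (Hincr := radius_sqr_incr (gamma - 1) K B k1 k2 ltac:(lra) K_pos kappa1_pos).
  destruct (Rtotal_order (rho S r) c) as [H|[H|H]].
  - assert (rsq (rho S r) < rsq c) by (apply Hincr; [split|..]; assumption).
    assert (r < rc) by nra. apply Hty1 in H. repeat split; intros; lra.
  - assert (r = rc) by (rewrite H in Hrs; nra).
    assert (sound_speed_sqr gamma (rho S r) A0 = 2 * kin (rho S r)).
    { destruct (Rtotal_order (sound_speed_sqr gamma (rho S r) A0)
                  (2 * kin (rho S r))) as [G|[G|G]]; [|exact G|].
      - apply Hty1 in G. lra.
      - apply Hty2 in G. lra. }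
    repeat split; intros; lra.
  - assert (rsq c < rsq (rho S r)) by (apply Hincr; [split|..]; assumption).
    assert (rc < r) by nra. apply Hty2 in H. repeat split; intros; lra.
Qed.

Lemma supersonic_inflow :
  U10 ^ 2 > sound_speed_sqr gamma rho0 A0 ->
  exists_unique_flow r0 r1 (fun S =>
    smooth_solution gamma r0 r1 rho0 A0 U10 U20 S /\ supersonic gamma r0 r1 S).
Proof.
  intros Hsup. destruct inflow_state as [_ [_ [_ Hm0]]].
  destruct smooth_solution_exists_unique as [S [HS [Hu Hmar]]]; [lra|].
  apply exists_unique_flow_of_solution with S; try assumption.
  intros r Hr. assert (Hr' : r0 <= r <= r1) by lra.
  destruct (first_integrals S HS r Hr') as [F1 [_ [F3 _]]].
  destruct (radius_sqr_density S HS r Hr') as [D1 [D2 [D3 _]]].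
  assert (Hms := margin_sound_speed r (rho S r) (U1 S r) ltac:(lra) D1 D2 D3 F1).
  unfold supersonic_at, speed_sqr. rewrite F3.
  assert (W2 := pow2_ge_0 (U2 S r)).
  assert (Hneg0 : mar rho0 < 0).
  { rewrite Hm0. assert (W := weight_pos rho0). nra. }
  assert (Hneg : mar (rho S r) < 0) by (specialize (Hmar r Hr'); nra).
  assert (W := weight_pos (rho S r)).
  assert (sound_speed_sqr gamma (rho S r) A0 - U1 S r ^ 2 < 0); [|lra].
  rewrite Hms in Hneg. nra.
Qed.

Lemma subsonic_inflow :
  speed_sqr U10 U20 < sound_speed_sqr gamma rho0 A0 ->
  exists_unique_flow r0 r1 (fun S =>
    smooth_solution gamma r0 r1 rho0 A0 U10 U20 S /\ subsonic gamma r0 r1 S).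
Proof.
  intros Hsub. destruct inflow_state as [Hk0 [Hr0 [Hsp Hm0]]].
  assert (HU20 := pow2_ge_0 U20).
  assert (Hc0 : 0 < sound_speed_sqr gamma rho0 A0 - U10 ^ 2)
    by (unfold speed_sqr in Hsub; lra).
  assert (Hpos0 : 0 < mar rho0)
    by (rewrite Hm0; apply Rmult_lt_0_compat; [apply weight_pos|lra]).
  destruct smooth_solution_exists_unique as [S [HS [Hu Hmar]]]; [lra|].
  apply exists_unique_flow_of_solution with S; try assumption.
  intros r Hr. assert (Hr' : r0 <= r <= r1) by lra.
  destruct (first_integrals S HS r Hr') as [_ [_ [F3 _]]].
  destruct (radius_sqr_density S HS r Hr') as [D1 [D2 [D3 D4]]].
  unfold subsonic_at. rewrite D4, F3. apply type_of_density; [exact D1|].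
  apply Rlt_le_trans with rho0; [apply type_of_density; [exact hrho0|lra]|].
  (* A density below [rho0] would belong to a radius below [r0]. *)
  apply Rnot_lt_le. intros Hlt.
  assert (rsq (rho S r) < rsq rho0).
  { apply radius_sqr_incr; [lra|exact K_pos|exact kappa1_pos|now split|exact Hk0|].
    specialize (Hmar r Hr'). nra. }
  nra.
Qed.

(** Here [rho0 < rho_c] and the margin is positive at [rho0], hence also at
    [rho_c]: the critical density lies ahead on the branch of the inflow. *)
Lemma supersonic_radially_subsonic_inflow :
  speed_sqr U10 U20 > sound_speed_sqr gamma rho0 A0 ->
  sound_speed_sqr gamma rho0 A0 > U10 ^ 2 ->
  r_c gamma r0 rho0 A0 U10 U20 > r0 /\
  exists S, smooth_solution gamma r0 r1 rho0 A0 U10 U20 S /\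
    (forall T, smooth_solution gamma r0 r1 rho0 A0 U10 U20 T ->
       flow_eq_on r0 r1 S T) /\
    (forall T, smooth_solution gamma r0 r1 rho0 A0 U10 U20 T ->
     forall r, r0 <= r <= r1 ->
       (supersonic_at gamma T r <-> r < r_c gamma r0 rho0 A0 U10 U20) /\
       (sonic_at gamma T r <-> r = r_c gamma r0 rho0 A0 U10 U20) /\
       (subsonic_at gamma T r <-> r_c gamma r0 rho0 A0 U10 U20 < r)).
Proof.
  intros Hsup Hrad. destruct inflow_state as [Hk0 [Hr0 [Hsp Hm0]]].
  assert (Hpos0 : 0 < mar rho0)
    by (rewrite Hm0; apply Rmult_lt_0_compat; [apply weight_pos|lra]).
  assert (Hc0 : rho0 < rho_c gamma rho0 A0 U10 U20)
    by (apply type_of_density; [exact hrho0|lra]).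
  assert (Hposc : 0 < mar (rho_c gamma rho0 A0 U10 U20)).
  { apply Rlt_trans with (1 := Hpos0).
    apply margin_incr; [lra|exact K_pos|exact kappa1_pos|lra]. }
  split.
  - assert (H := r_c_sqr).
    assert (rsq rho0 < rsq (rho_c gamma rho0 A0 U10 U20)).
    { apply radius_sqr_incr; [lra|exact K_pos|exact kappa1_pos|now split| |exact Hpos0].
      apply kinetic_rho_c_pos. }
    assert (0 <= r_c gamma r0 rho0 A0 U10 U20) by apply sqrt_pos.
    nra.
  - destruct smooth_solution_exists_unique as [S [HS [Hu Hmar]]]; [lra|].
    exists S. split; [exact HS|split; [exact Hu|]].
    intros T HT. apply type_at_radius; [exact HT| |exact Hposc].
    intros r Hr. destruct (Hu T HT r Hr) as [_ [_ [E _]]]. rewrite <- E.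
    specialize (Hmar r Hr). nra.
Qed.

End Flow.

Theorem theorem2p1 (gamma r0 r1 rho0 A0 U10 U20 : R)
    (hgamma : 1 < gamma) (hr0 : 0 < r0) (hr01 : r0 < r1)
    (hrho0 : 0 < rho0) (hA0 : 0 < A0) (hU10 : 0 < U10) :
  (U10 ^ 2 > sound_speed_sqr gamma rho0 A0 ->
     exists_unique_flow r0 r1 (fun S =>
       smooth_solution gamma r0 r1 rho0 A0 U10 U20 S /\
       supersonic gamma r0 r1 S))
  /\
  (speed_sqr U10 U20 < sound_speed_sqr gamma rho0 A0 ->
     exists_unique_flow r0 r1 (fun S =>
       smooth_solution gamma r0 r1 rho0 A0 U10 U20 S /\
       subsonic gamma r0 r1 S))
  /\
  (speed_sqr U10 U20 > sound_speed_sqr gamma rho0 A0 ->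
   sound_speed_sqr gamma rho0 A0 > U10 ^ 2 ->
     r_c gamma r0 rho0 A0 U10 U20 > r0 /\
     (r1 > r_c gamma r0 rho0 A0 U10 U20 ->
        exists_unique_flow r0 r1 (fun S =>
          smooth_solution gamma r0 r1 rho0 A0 U10 U20 S /\
          transonic gamma r0 r1 S)) /\
     (r1 < r_c gamma r0 rho0 A0 U10 U20 ->
        exists_unique_flow r0 r1 (fun S =>
          smooth_solution gamma r0 r1 rho0 A0 U10 U20 S /\
          supersonic gamma r0 r1 S)) /\
     (r1 = r_c gamma r0 rho0 A0 U10 U20 ->
        exists_unique_flow r0 r1 (fun S =>
          smooth_solution gamma r0 r1 rho0 A0 U10 U20 S /\
          supersonic_sonic gamma r0 r1 S) /\
        (forall S,
          smooth_solution gamma r0 r1 rho0 A0 U10 U20 S ->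
          supersonic_sonic gamma r0 r1 S ->
          forall r, r0 <= r <= r1 ->
            (sonic_at gamma S r <-> r = r_c gamma r0 rho0 A0 U10 U20)))).
Proof.
  split; [now apply supersonic_inflow|split; [now apply subsonic_inflow|]].
  intros Hsup Hrad.
  destruct (supersonic_radially_subsonic_inflow gamma r0 r1 rho0 A0 U10 U20
              hgamma hr0 hr01 hrho0 hA0 hU10 Hsup Hrad)
    as [Hrc [S [HS [Hu Htype]]]].
  assert (HtypeS := Htype S HS).
  split; [exact Hrc|split; [|split]].
  - intros Hr1. apply exists_unique_flow_of_solution with S; try assumption.
    exists (r_c gamma r0 rho0 A0 U10 U20). split; [lra|split].
    + apply HtypeS; [lra|reflexivity].
    + left. split; intros r Hr; apply HtypeS; lra.
  - intros Hr1. apply exists_unique_flow_of_solution with S; try assumption.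
    intros r Hr. apply HtypeS; lra.
  - intros Hr1. split.
    + apply exists_unique_flow_of_solution with S; try assumption.
      split; [|apply HtypeS; lra]. intros r Hr. apply HtypeS; lra.
    + intros T HT _ r Hr. now apply Htype.
Qed.
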